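(* For any bounded graph $\mathfrak{F}=\langle W,R\rangle$ there exist a set $I$ and an ultrafilter $D$ over $I$ such that $\mathfrak{F}\preceq\mathfrak{F}^{\mathfrak{ue}}\preceq{}^I\mathfrak{F}/D$; here $\mathfrak{F}$ is identified with its image in $\mathfrak{F}^{\mathfrak{ue}}$ under the canonical embedding $w\mapsto\pi_w=\{X\subseteq W:w\in X\}$, and $\mathfrak{F}^{\mathfrak{ue}}$ is identified with its image under an embedding into ${}^I\mathfrak{F}/D$.
   Context: A directed graph is bounded if there is $m\in\omega$ with $|\{s:Rws\}|+|\{s:Rsw\}|\leq m$ for all $w\in W$. The ultrafilter extension is $\mathfrak{F}^{\mathfrak{ue}}=\langle\mathrm{Uf}(W),R^{\mathfrak{ue}}\rangle$, $\mathrm{Uf}(W)$ the set of ultrafilters over $W$, $R^{\mathfrak{ue}}uv$ iff $\{w:\exists s\,(Rws\wedge s\in X)\}\in u$ for all $X\in v$. ${}^I\mathfrak{F}/D$ is the ultrapower. $\preceq$ denotes elementary substructure in the first-order language with one binary relation symbol and equality. *)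

(* Defs.v *)
From mathcomp Require Import all_boot.
From mathcomp Require Import boolp classical_sets functions cardinality filter.

Set Implicit Arguments.
Unset Strict Implicit.
Unset Printing Implicit Defensive.

Local Open Scope classical_set_scope.
Local Open Scope card_scope.

Record digraph : Type := Digraph {
  vertex :> Type;
  edge : vertex -> vertex -> Prop
}.

Definition bounded (F : digraph) : Prop :=
  exists m : nat, forall w : F, exists a b : nat,
    [/\ [set s | edge w s] #= `I_a, [set s | edge s w] #= `I_b & (a + b <= m)%N].

(* [formula n]: formulas with free variables among x_0, ..., x_(n-1), so that
   sentences ([formula 0]) can be evaluated in the empty structure too. The
   quantifier binds de Bruijn index 0. *)
Inductive formula : nat -> Type :=
| FEq (n : nat) (i j : 'I_n) : formula n
| FRel (n : nat) (i j : 'I_n) : formula n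
| FNot (n : nat) (p : formula n) : formula n
| FAnd (n : nat) (p q : formula n) : formula n
| FEx (n : nat) (p : formula n.+1) : formula n.

Definition extend (T : Type) (n : nat) (x : T) (v : 'I_n -> T) : 'I_n.+1 -> T :=
  fun i => if unlift ord0 i is Some j then v j else x.

Fixpoint sat (F : digraph) (n : nat) (p : formula n) : ('I_n -> F) -> Prop :=
  match p in formula n return ('I_n -> F) -> Prop with
  | FEq _ i j => fun v => v i = v j
  | FRel _ i j => fun v => edge (v i) (v j)
  | FNot _ q => fun v => ~ sat q v
  | FAnd _ q r => fun v => sat q v /\ sat r v
  | FEx _ q => fun v => exists x : F, sat q (extend x v)
  end.

(* The image of [e], as an induced substructure of [G] isomorphic to [F] via
   [e], is an elementary substructure of [G]. Atomic formulas make [e] injective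
   and edge-preserving and edge-reflecting. *)
Definition elementary_embedding (F G : digraph) (e : F -> G) : Prop :=
  forall (n : nat) (p : formula n) (v : 'I_n -> F), sat p v <-> sat p (e \o v).

Definition Uf (W : Type) : Type := {u : set_system W | UltraFilter u}.

Definition ue (F : digraph) : digraph :=
  @Digraph (Uf F) (fun u v => forall X : set F, sval v X ->
    sval u [set w | exists s : F, edge w s /\ X s]).

Definition pi_ue (F : digraph) (w : F) : ue F :=
  exist _ (principal_filter w) (principal_filter_ultra w).

(* Elements are the equivalence classes of functions I -> F modulo equality
   D-almost everywhere. When D is a filter, the existential in the edge relation
   does not depend on the representatives. *)
Definition ultrapower (F : digraph) (I : Type) (D : set_system I) : digraph :=
  @Digraph
    {C : set (I -> F) | exists f, C = [set g | D [set i | f i = g i]]}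
    (fun C C' => exists f g, [/\ sval C f, sval C' g &
       D [set i | edge (f i) (g i)]]).

(* Main.v *)
Require Import Defs.
From mathcomp Require Import all_boot.
From mathcomp Require Import boolp classical_sets functions cardinality filter.
From mathcomp Require Import wochoice.
From Stdlib Require List.

(** In a bounded graph the neighbours of a point are listed by finitely many
    functions [g k : F -> F], so the component of a point is its orbit under
    words in the [g k]. An ultrafilter contains [act w = act w'] as soon as its
    images under the two words coincide (a two-colouring along a well-order), so
    each component of the ultrafilter extension is described by the countably
    many sets [act w = act w'] and [edge (act w) (act w')] belonging to one of
    its points [u], exactly like the component of any [x] in the ultrapower
    whose image ultrafilter [st x := push x D] is [u].

    Take [D] on [I := Uf F -> F] extending the filter of boxes: then every
    ultrafilter is [st] of a coordinate function, and lifting one point per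
    component gives a section [e] of [st] whose image is a union of components.
    The image is elementary by the Tarski-Vaught test. If [b] lies outside it,
    [st b] is nonprincipal, so its countable type is realized by an ultrafilter
    [v] outside the countably many points connected to the given parameters;
    swapping the isomorphic components of [b] and [e v] is an automorphism that
    fixes the parameters and moves [b] into the image. Finally [e] composed with
    [pi_ue] is the diagonal embedding, which is elementary by Los's theorem. *)

Set Implicit Arguments.
Unset Strict Implicit.
Unset Printing Implicit Defensive.

Local Open Scope classical_set_scope.

(** * Well-orders and two-colourings *)

Lemma wf_total_order_exists (T : Type) : exists lt : T -> T -> Prop,
  well_founded lt /\ forall x y, [\/ lt x y, x = y | lt y x].
Proof.
have [R Rwo] := well_ordering_principle {classic T}.
have Rwo' : wo_chain R predT by move=> A _; exact: Rwo.
have Ranti := wo_chain_antisymmetric Rwo'.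
have Rtot := wo_chainW Rwo'.
pose lt (x y : T) := R x y /\ x <> y.
exists lt; split=> [|x y]; last first.
  have [->|xy] := pselect (x = y); first exact: Or32.
  have /orP[Rxy|Ryx] := Rtot x y isT isT; first exact: Or31.
  by apply: Or33; split=> // yx; exact: xy.
move=> x; apply: contrapT => nAx.
pose A : {pred {classic T}} := fun y => `[< ~ Acc lt y >].
have [|z [[/asboolP Az lbz] _]] := Rwo A; first by exists x; exact/asboolP.
apply: Az; constructor=> y [Ryz yz]; apply: contrapT => nAy; apply: yz.
by apply: Ranti => //; rewrite Ryz lbz//; exact/asboolP.
Qed.

(** Well-founded recursion: a point takes the colour opposite to its image when the image lies below
    it, and [true] otherwise. *)
Lemma descending_two_coloring (T : Type) (lt : T -> T -> Prop) (h : T -> T) :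
  well_founded lt ->
  exists c : T -> bool, forall x, lt (h x) x -> c x = ~~ c (h x).
Proof.
move=> wf.
pose step x (rec : forall y, lt y x -> bool) :=
  if pselect (lt (h x) x) is left hx then ~~ rec (h x) hx else true.
exists (Fix wf (fun=> bool) step) => x hx.
rewrite Fix_eq /step; first by case: pselect.
by move=> y f g fg; case: pselect => // a; rewrite fg.
Qed.

(** * Ultrafilters, their images and fixed points *)

Section Ultrafilters.
Context {T : Type}.
Implicit Types (u v : Uf T) (A B : set T).

#[global] Instance uf_ultra u : UltraFilter (sval u) := svalP u.

Lemma uf_eq u v : sval u `<=` sval v -> u = v.
Proof.
move=> uv; apply: eq_sig_hprop => [P p q|]; first exact: Prop_irrelevance.
by rewrite (max_filter _ uv).
Qed.

Lemma ufC u A : sval u (~` A) <-> ~ sval u A.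
Proof.
split=> [uCA uA|nuA]; last by have [|//] := in_ultra_setVsetC A (uf_ultra u).
by have [x []] := filter_ex (filterI uCA uA).
Qed.

Lemma uf_neqP u v : u <> v -> exists2 A, sval v A & ~ sval u A.
Proof.
move=> uv; apply: contrapT => nex; apply: uv; apply/esym/uf_eq => A vA.
by apply: contrapT => nuA; apply: nex; exists A.
Qed.

Lemma uf_exists (K : finType) (A : K -> set T) u :
  sval u [set x | exists k, A k x] -> exists k, sval u (A k).
Proof.
move=> uA; apply: contrapT => /forallNP nA.
have uC : sval u [set x | forall k, (~` A k) x].
  by apply: filter_forall => k; apply/ufC.
by have [x [[k Akx] /(_ k)]] := filter_ex (filterI uA uC).
Qed.

Lemma ultrafilter_of_setVsetC (D : set_system T) :
  ProperFilter D -> (forall A, D A \/ D (~` A)) -> UltraFilter D.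
Proof.
move=> DF DC; split=> // G GF DG; apply/seteqP; split=> // A GA.
have [//|/DG GCA] := DC A.
by have [x []] := filter_ex (filterI GA GCA).
Qed.

End Ultrafilters.

Lemma push_ultra (T U : Type) (f : T -> U) (u : Uf T) :
  UltraFilter [set A | sval u (f @^-1` A)].
Proof.
apply: ultrafilter_of_setVsetC => A.
exact: (in_ultra_setVsetC (f @^-1` A) (uf_ultra u)).
Qed.

Definition push (T U : Type) (f : T -> U) (u : Uf T) : Uf U :=
  exist _ _ (push_ultra f u).

Lemma pushE (T U : Type) (f : T -> U) (u : Uf T) A :
  sval (push f u) A = sval u [set x | A (f x)].
Proof. by []. Qed.

Lemma push_comp (T U V : Type) (f : T -> U) (h : U -> V) (u : Uf T) :
  push h (push f u) = push (h \o f) u.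
Proof. exact: uf_eq. Qed.

Lemma push_ae_eq (T U : Type) (f h : T -> U) (u : Uf T) :
  sval u [set x | f x = h x] -> push f u = push h u.
Proof.
move=> fh; apply: uf_eq => A; rewrite !pushE => uA.
by apply: filterS2 fh uA => x /= ->.
Qed.

Lemma push_id (T : Type) (u : Uf T) : push id u = u.
Proof. exact: uf_eq. Qed.

(** One colour class belongs to [u], and so does its preimage under [h], since [h] fixes [u]; at a
    descending point the two colours differ. *)
Lemma push_descending (T : Type) (lt : T -> T -> Prop) (h : T -> T) (u : Uf T) :
  well_founded lt -> push h u = u -> ~ sval u [set x | lt (h x) x].
Proof.
move=> wf hu uh; have [c cP] := descending_two_coloring h wf.
have noC (b : bool) : ~ sval u [set x | c x = b].
  move=> uc; have := uc; rewrite -{1}hu pushE /= => uch.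
  have [x /= [[chx cx] hx]] := filter_ex (filterI (filterI uch uc) uh).
  by move: (cP x hx); rewrite chx cx; case: (b).
apply: (noC true); apply: contrapT => /ufC nc; apply: (noC false).
by apply: filterS nc => x /= /negP/negbTE.
Qed.

(** Where [h'] undoes [h], a moved point [x] has [h] descending at [x] or [h'] descending at [h x].
    Both maps fix [u], so [push_descending] excludes either case. *)
Lemma push_fixed (T : Type) (h h' : T -> T) (u : Uf T) :
  sval u [set x | h' (h x) = x] -> push h u = u -> sval u [set x | h x = x].
Proof.
move=> h'h hu; have [lt [wf tri]] := wf_total_order_exists T.
apply: contrapT => /ufC nh; apply: (push_descending wf hu).
apply: contrapT => /ufC nlt.
have h'u : push h' u = u.
  by rewrite -{1}hu push_comp -[RHS]push_id; exact: push_ae_eq.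
apply: (push_descending wf h'u); rewrite -hu pushE.
by apply: filterS3 h'h nh nlt => x /= -> hx nltx; have [] := tri (h x) x.
Qed.

Definition principal (T : Type) (x : T) : Uf T :=
  exist _ (principal_filter x) (principal_filter_ultra x).

Lemma eq_principal (T : Type) (u : Uf T) x : sval u [set x] -> u = principal x.
Proof.
move=> ux; apply/esym/uf_eq => A /principal_filterP Ax.
by apply: filterS ux => _ ->.
Qed.

(** * Realizing countable types by ultrafilters *)

Lemma injective_selection (T : Type) (U : nat -> set T) :
  (forall n (l : seq T), exists x, U n x /\ ~ List.In x l) ->
  exists s : nat -> T, injective s /\ forall n, U n (s n).
Proof.
move=> /(_ _ _)/cid-H; pose next l := sval (H (size l) l).
pose L n := iter n (fun l => next l :: l) [::].
have szL n : size (L n) = n by elim: n => //= n ->.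
have nextP n : U n (next (L n)) /\ ~ List.In (next (L n)) (L n).
  by rewrite -{1}(szL n) /next; case: (H _ _) => x [].
have inL m n : m < n -> List.In (next (L m)) (L n).
  elim: n => // n IHn; rewrite ltnS leq_eqVlt => /orP[/eqP->|/IHn]; [by left|by right].
exists (fun n => next (L n)); split=> [m n mn|n]; last by have [] := nextP n.
have [/inL|/inL|//] := ltngtP m n.
- by rewrite mn => /(proj2 (nextP n)).
- by rewrite -mn => /(proj2 (nextP m)).
Qed.

Lemma nonprincipal_notin (T : Type) (u : Uf T) (l : seq T) :
  (forall x, u <> principal x) -> sval u [set x | ~ List.In x l].
Proof.
move=> np; elim: l => [|y l IHl]; first by apply: filterS filterT => x _ [].
have uy : sval u (~` [set y]) by apply/ufC => uy; exact: np (eq_principal uy).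
by apply: filterS2 uy IHl => x /= xy xl [yx|//]; exact: xy.
Qed.

Lemma uf_countable_inter (T : Type) (J : countType) (U : J -> set T) (u : Uf T) n :
  (forall j, sval u (U j)) ->
  sval u [set x | forall j, pickle j < n -> U j x].
Proof.
move=> uU; elim: n => [|n IHn]; first by apply: filterS filterT.
suff un : sval u [set x | forall j, pickle j = n -> U j x].
  apply: filterS2 un IHn => x /= un IHn j.
  by rewrite ltnS leq_eqVlt => /orP[/eqP/un|/IHn].
have [[j <-]|nj] := pselect (exists j : J, pickle j = n).
  by apply: filterS (uU j) => x Ux i /(pcan_inj pickleK)->.
by apply: filterS filterT => x _ j jn; case: nj; exists j.
Qed.

(* The points [s l], [l : seq bool], are pairwise distinct, so no ultrafilter
   contains both [Q k true] and [Q k false]. Following the branch of the binary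
   tree that at level [k] avoids the [k]-th ultrafilter of the list gives a
   sequence all of whose cluster points differ from every [z j]. *)
Lemma countable_type_realized_off (T : Type) (J J' : countType)
    (S : J -> set T) (z : J' -> Uf T) (u : Uf T) :
  (forall x, u <> principal x) ->
  exists v : Uf T, (forall j, sval u (S j) <-> sval v (S j)) /\
                   forall j, v <> z j.
Proof.
move=> np.
pose U j := if pselect (sval u (S j)) then S j else ~` S j.
have uU j : sval u (U j) by rewrite /U; case: pselect => // nuS; exact/ufC.
(* The code of a node [l] imposes the conditions numbered below [size l]; a number coding no node
   imposes none. *)
pose V (n : nat) : set T :=
  let d := if unpickle n is Some l then size (l : seq bool) else 0 in
  [set x | forall j, pickle j < d -> U j x].
have [|s' [s'inj s'V]] := @injective_selection T V.
  move=> n l; pose d := if unpickle n is Some l then size (l : seq bool) else 0.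
  exact: filter_ex (filterI (uf_countable_inter d uU) (nonprincipal_notin l np)).
pose s (l : seq bool) := s' (pickle l).
have sinj : injective s by move=> l l' /s'inj/(pcan_inj pickleK).
have sU l j : pickle j < size l -> U j (s l).
  by move: (s'V (pickle l)); rewrite /V pickleK; apply.
pose Q k (c : bool) := [set x | exists l, [/\ k < size l, nth false l k = c & x = s l]].
have /choice[b bP] : forall k, exists c,
    forall j, pickle j = k -> ~ sval (z j) (Q k c).
  move=> k.
  have [[j jk]|nj] := pselect (exists j : J', pickle j = k); last first.
    by exists true => j jk; case: nj; exists j.
  have [zt|zt] := pselect (sval (z j) (Q k true)); last first.
    by exists true => i; rewrite -jk => /(pcan_inj pickleK)->; rewrite jk.
  exists false => i; rewrite -{1}jk => /(pcan_inj pickleK)-> zf.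
  have [x [[l [_ lt ->]] [l' [_ lf /sinj ll']]]] := filter_ex (filterI zt zf).
  by move: lf; rewrite -ll' lt.
pose p n := s (mkseq b n).
(* [v] contains every set that contains a tail of the branch [b]. *)
have [v [vU pv]] := ultraFilterLemma (fmap_proper_filter p eventually_filter).
have tail n A : (forall m, n <= m -> A (p m)) -> v A by move=> nA; apply: pv; exists n.
exists (exist _ v vU); split=> [j|j vz].
  have vUj : v (U j).
    by apply: (tail (pickle j).+1) => m jm; apply: sU; rewrite size_mkseq.
  move: vUj; rewrite /U; case: pselect => // nuS vC; split=> // vS.
  by have [x []] := filter_ex (filterI vC vS).
apply: (bP (pickle j) j erefl); rewrite -vz /=.
apply: (tail (pickle j).+1) => m jm; exists (mkseq b m).
by rewrite size_mkseq nth_mkseq.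
Qed.

(** * Automorphisms and elementary embeddings *)

Lemma extend_comp (S T : Type) (h : S -> T) n (x : S) (v : 'I_n -> S) :
  extend (h x) (h \o v) = h \o extend x v.
Proof. by apply/funext => i; rewrite /extend /=; case: unlift. Qed.

Definition involutive_automorphism (G : digraph) (s : G -> G) :=
  involutive s /\ forall x y : G, edge x y -> edge (s x) (s y).

Lemma sat_automorphism (G : digraph) (s : G -> G) n (p : formula n)
  (v : 'I_n -> G) :
  involutive_automorphism s -> sat p v <-> sat p (s \o v).
Proof.
move=> [sK sE]; elim: p v => {n} [n i j|n i j|n p IH|n p IHp q IHq|n p IH] v /=.
- by split=> [->//|/(inv_inj sK)].
- by split=> [/sE//|/sE]; rewrite !sK.
- by rewrite IH.
- by rewrite IHp IHq.
- split=> -[x]; first by move=> /IH; rewrite -extend_comp; exists (s x).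
  move=> px; exists (s x); apply/IH.
  by rewrite -extend_comp sK.
Qed.

Lemma Tarski_Vaught_automorphism (M N : digraph) (e : M -> N) :
  injective e -> (forall x y : M, edge x y <-> edge (e x) (e y)) ->
  (forall n (a : 'I_n -> M) (b : N), exists s : N -> N,
     [/\ involutive_automorphism s, s \o (e \o a) = e \o a &
         exists b', s b = e b']) ->
  elementary_embedding e.
Proof.
move=> einj eE mv n p.
elim: p => {n} [n i j|n i j|n p IH|n p IHp q IHq|n p IH] v /=.
- by split=> [->//|/einj].
- exact: eE.
- by rewrite IH.
- by rewrite IHp IHq.
- split=> -[x]; first by move=> /IH; rewrite -extend_comp; exists (e x).
  have [s [sA sv [x' sx]]] := mv _ v x.
  move=> /(sat_automorphism _ _ sA); rewrite -extend_comp sv sx extend_comp.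
  by move=> /IH; exists x'.
Qed.

Section Swap.
Variables (G : digraph) (P : G -> G -> Prop).
Hypothesis P_fun : forall x y y', P x y -> P x y' -> y = y'.
Hypothesis P_inj : forall x x' y, P x y -> P x' y -> x = x'.
Hypothesis P_disj : forall x y z, P x y -> P y z -> False.
Hypothesis P_dom : forall x x' y, P x x' -> edge x y \/ edge y x ->
  exists y', P y y'.
Hypothesis P_cod : forall x x' y, P x' x -> edge x y \/ edge y x ->
  exists y', P y' y.
Hypothesis P_edge : forall x x' y y', P x x' -> P y y' ->
  edge x y <-> edge x' y'.

(** [P] is the graph of an isomorphism between two disjoint unions of components. Exchanging them
    and fixing all other points preserves edges, as no edge leaves either union. *)
Lemma swap_automorphism : exists s : G -> G,
  [/\ involutive_automorphism s, forall x y, P x y -> s x = y &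
      forall x, (forall y, ~ P x y) -> (forall y, ~ P y x) -> s x = x].
Proof.
pose Q x y := P x y \/ P y x.
have Q_fun x y y' : Q x y -> Q x y' -> y = y'.
  move=> [xy|yx] [xy'|y'x]; [exact: P_fun xy xy'| | |exact: P_inj yx y'x].
  - by case: (P_disj y'x xy).
  - by case: (P_disj yx xy').
have Q_dom x x' y : Q x x' -> edge x y \/ edge y x -> exists y', Q y y'.
  move=> [xx'|x'x] xy.
    by have [y' ?] := P_dom xx' xy; exists y'; left.
  by have [y' ?] := P_cod x'x xy; exists y'; right.
have Q_edge x x' y y' : Q x x' -> Q y y' -> edge x y -> edge x' y'.
  move=> [xx'|x'x] [yy'|y'y] xy.
  - exact/(P_edge xx' yy').
  (* The edge puts [y] in the domain of [P], yet [y] is already in its range. *)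
  - have [z yz] := P_dom xx' (or_introl xy).
    by case: (P_disj y'y yz).
  - have [z xz] := P_dom yy' (or_intror xy).
    by case: (P_disj x'x xz).
  - exact/(P_edge x'x y'y).
have /choice[s sP] : forall x, exists y, Q x y \/ ((forall z, ~ Q x z) /\ y = x).
  move=> x; have [[y xy]|/forallNP nx] := pselect (exists y, Q x y).
    by exists y; left.
  by exists x; right.
have sQ x y : Q x y -> s x = y.
  by move=> xy; have [/Q_fun-/(_ _ xy)//|[/(_ _ xy)]] := sP x.
have sN x : (forall z, ~ Q x z) -> s x = x by move=> nx; have [/nx|[]] := sP x.
exists s; split=> [|x y xy|x nl nr]; last 2 first.
- by apply: sQ; left.
- by apply: sN => y [/nl|/nr].
split=> [x|x y xy].
  have [sx|[nx sx]] := sP x; last by rewrite !sx.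
  by apply: sQ; case: sx; [right|left].
have [xx'|[nx ->]] := sP x.
  have [y' yy'] := Q_dom _ _ _ xx' (or_introl xy).
  by rewrite (sQ _ _ yy'); exact: Q_edge xx' yy' xy.
rewrite sN // => z yz.
by have [x' /nx] := Q_dom _ _ _ yz (or_intror xy).
Qed.

End Swap.

(** * Ultrapowers and the theorem of Los *)

Section Ultrapower.
Variables (F : digraph) (I : Type) (D : Uf I).
Implicit Types (f h : I -> F).
Local Notation "*F" := (ultrapower F (sval D)).

Definition upclass f : *F :=
  exist _ [set h | sval D [set i | f i = h i]] (ex_intro _ f erefl).

Lemma upclass_surj (x : *F) : exists f, x = upclass f.
Proof. by case: x => C [f fC]; exists f; exact: eq_exist. Qed.

Lemma upclass_eq f h : upclass f = upclass h <-> sval D [set i | f i = h i].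
Proof.
split=> [fh|fh].
  have : sval (upclass h) h by apply: filterS filterT.
  by rewrite -fh.
apply: eq_exist; apply/seteqP; split=> k /=.
  by move=> fk; apply: filterS2 fh fk => i /= ->.
by move=> hk; apply: filterS2 fh hk => i /= ->.
Qed.

Lemma upclass_edge f h :
  edge (upclass f) (upclass h) <-> sval D [set i | edge (f i) (h i)].
Proof.
split=> [[f' [h' [/= ff' hh' fh']]]|fh].
  by apply: filterS3 ff' hh' fh' => i /= -> ->.
by exists f, h; split=> //=; apply: filterS filterT.
Qed.

Theorem Los n (p : formula n) (f : 'I_n -> I -> F) :
  sat p (upclass \o f) <-> sval D [set i | sat p (fun j => f j i)].
Proof.
elim: p f => {n} [n i j|n i j|n p IH|n p IHp q IHq|n p IH] f /=.
- exact: upclass_eq.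
- exact: upclass_edge.
- by rewrite IH -ufC.
- rewrite IHp IHq; split=> [[]|pq]; first exact: filterI.
  by split; apply: filterS pq => i [].
have extE h i : (fun j => extend h f j i) = extend (h i) (fun j => f j i).
  by apply/esym; exact: (extend_comp (fun k : I -> F => k i)).
split=> [[x]|Dp].
  have [h ->] := upclass_surj x; rewrite extend_comp => /IH.
  by apply: filterS => i /=; rewrite extE; exists (h i).
(* Some index has a witness [x0], which serves as default value where there is none. *)
have [_ [x0 _]] := filter_ex Dp.
have /choice[h hP] : forall i, exists x : F,
    (exists y, sat p (extend y (fun j => f j i))) ->
    sat p (extend x (fun j => f j i)).
  move=> i; have [[y py]|np] := pselect (exists y, sat p (extend y (fun j => f j i))).
    by exists y.
  by exists x0.
exists (upclass h); rewrite extend_comp; apply/IH.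
by apply: filterS Dp => i /= /hP; rewrite extE.
Qed.

Lemma diagonal_elementary :
  elementary_embedding (fun x : F => upclass (fun=> x)).
Proof.
move=> n p v; rewrite -[X in _ <-> sat _ X]/(upclass \o (fun j => fun=> v j)) Los /=.
split=> [pv|/filter_ex[]//]; exact: filterS filterT.
Qed.

End Ultrapower.

Lemma class_representative (T : Type) (R : T -> T -> Prop) :
  (forall x, R x x) -> (forall x y, R x y -> R y x) ->
  (forall x y z, R x y -> R y z -> R x z) ->
  exists c : T -> T, (forall x, R (c x) x) /\ forall x y, R x y -> c x = c y.
Proof.
move=> Rxx Rsym Rtr.
have /choice[h hP] : forall S : {S : set T | exists x, S x}, exists x, sval S x.
  by case.
(* The representative is chosen from the class as a set, so equal classes yield equal choices. *)
pose cl x : {S : set T | exists x, S x} := exist _ (R x) (ex_intro _ x (Rxx x)).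
exists (fun x => h (cl x)); split=> [x|x y xy]; first exact/Rsym/(hP (cl x)).
congr h; apply: eq_exist; apply/seteqP; split=> z; apply: Rtr => //.
exact: Rsym.
Qed.

(** Boxes with sides [A u] in [u] are nonempty by choice and closed under intersection, so one
    ultrafilter contains them all. *)
Lemma coordinates_realize_all (T : Type) : exists D : Uf (Uf T -> T),
  forall u : Uf T, push (fun i => i u) D = u.
Proof.
pose box (A : Uf T -> set T) : set (Uf T -> T) := [set i | forall u, A u (i u)].
pose D0 : set_system (Uf T -> T) :=
  [set S | exists A, (forall u, sval u (A u)) /\ box A `<=` S].
have D0F : ProperFilter D0.
  apply: Build_ProperFilter_ex => [S [A [uA AS]]|].
    have /choice[i iA] : forall u, exists x, A u x.
      by move=> u; exact: filter_ex (uA u).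
    by exists i; exact: AS.
  split.
  - by exists (fun=> setT); split=> // u; exact: filterT.
  - move=> S S' [A [uA AS]] [A' [uA' AS']].
    exists (fun u => A u `&` A' u); split=> [u|i Ai]; first exact: filterI.
    by split; [apply: AS|apply: AS'] => u; have [] := Ai u.
  - by move=> S S' SS' [A [uA AS]]; exists A; split=> // i /AS/SS'.
have [D [DU D0D]] := ultraFilterLemma D0F.
exists (exist _ D DU) => u; apply/esym/uf_eq => A uA.
(* The box restricted only at the coordinate [u], where its side is [A]. *)
apply: D0D; exists (fun v => [set x | v = u -> A x]); split=> [v|i]; last exact.
have [->|vu] := pselect (v = u); first by apply: filterS uA => x Ax _.
by apply: filterS filterT => x _ /vu.
Qed.

(** * Neighbour functions of a bounded graph *)

Definition neighbor (F : digraph) (p q : F) : Prop :=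
  [\/ q = p, edge p q | edge q p].

Lemma neighbor_sym (F : digraph) (p q : F) : neighbor p q -> neighbor q p.
Proof. by case=> [->|pq|qp]; [apply: Or31|apply: Or33|apply: Or32]. Qed.

(** Surplus indices take the value [p], which is harmless later because [neighbor] is reflexive. *)
Lemma enumerate_card_le (T : Type) (A : set T) (a m : nat) (p : T) :
  (A #= `I_a)%card -> a <= m -> exists h : 'I_m -> T,
    (forall i, h i = p \/ A (h i)) /\ forall s, A s -> exists i, h i = s.
Proof.
move=> /pcard_eqP[f] am.
have /choice[h hP] : forall i : 'I_m, exists x,
    (A x /\ f x = i) \/ (x = p /\ ~ exists y, A y /\ f y = i).
  move=> i; have [[x Ax]|nx] := pselect (exists x, A x /\ f x = i).
    by exists x; left.
  by exists p; right.
exists h; split=> [i|s As]; first by have [[]|[]] := hP i; [right|left].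
have fs : f s < m by apply: leq_trans am; exact: (@funS _ _ _ _ f s As).
exists (Ordinal fs); have [[Ah fh]|[_ []]] := hP (Ordinal fs); last by exists s.
by apply: (@inj _ _ _ f) => //; exact: mem_set.
Qed.

Lemma bounded_neighbor_functions (F : digraph) : bounded F ->
  exists (K : finType) (g : K -> F -> F),
    forall p q, neighbor p q <-> exists k, g k p = q.
Proof.
(* [m] slots for out-neighbours, [m] for in-neighbours and [None] for [p] itself; the bound makes
   [K] independent of [p]. *)
move=> [m mP]; pose K : finType := option ('I_m + 'I_m).
suff /choice[g gP] : forall p : F, exists g : K -> F,
    forall q, neighbor p q <-> exists k, g k = q.
  by exists K, (fun k p => g p k).
move=> p; have [a [b [Ea Eb abm]]] := mP p.
have [h [hA hs]] := enumerate_card_le p Ea (leq_trans (leq_addr _ _) abm).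
have [h' [hA' hs']] := enumerate_card_le p Eb (leq_trans (leq_addl _ _) abm).
exists (fun k : K => match k with
  | None => p | Some (inl i) => h i | Some (inr i) => h' i end) => q.
split=> [[->|/hs[i <-]|/hs'[i <-]]|[[[i|i]|] <-]].
- by exists None.
- by exists (Some (inl i)).
- by exists (Some (inr i)).
- by have [->|] := hA i; [apply: Or31|apply: Or32].
- by have [->|] := hA' i; [apply: Or31|apply: Or33].
- exact: Or31.
Qed.

(** * Words acting on points and on ultrafilters *)

Section NeighborFunctions.
Variables (F : digraph) (K : finType) (g : K -> F -> F).
Hypothesis gP : forall p q, neighbor p q <-> exists k, g k p = q.
Implicit Types (u v : Uf F) (w : seq K).

Definition act w (p : F) : F := foldr g p w.

Lemma act_cat w w' p : act (w ++ w') p = act w (act w' p).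
Proof. exact: foldr_cat. Qed.

Lemma push_act_cat w w' u : push (act (w ++ w')) u = push (act w) (push (act w') u).
Proof. by rewrite push_comp; congr push; apply/funext => p; rewrite act_cat. Qed.

(** The letter undoing a step depends on the point; with finitely many letters, one works on a set
    of [u]. *)
Lemma act_inverse w u : exists w', sval u [set p | act w' (act w p) = p].
Proof.
elim: w => [|k w [w' w'P]]; first by exists [::]; apply: filterS filterT.
have [k' k'P] : exists k', sval u [set p | g k' (g k (act w p)) = act w p].
  apply: uf_exists; apply: filterS filterT => p _ /=.
  by apply/gP/neighbor_sym/gP; exists k.
exists (w' ++ [:: k']); apply: filterS2 w'P k'P => p /= w'p k'p.
by rewrite act_cat /= k'p.
Qed.

Lemma push_act_inverse w u : exists w', push (act w') (push (act w) u) = u.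
Proof.
have [w' w'P] := act_inverse w u; exists w'.
by rewrite push_comp -[RHS]push_id; exact: push_ae_eq.
Qed.

(** If [w1] undoes [w] at [u], then [w' ++ w1] fixes [push (act w) u] and is invertible there, so
    [push_fixed] makes it the identity almost everywhere. *)
Lemma push_act_eq w w' u : push (act w) u = push (act w') u <->
  sval u [set p | act w p = act w' p].
Proof.
split=> [ww'|]; last exact: push_ae_eq.
have [w1 w1P] := act_inverse w u.
have [w2 w2P] := act_inverse (w' ++ w1) (push (act w) u).
have : push (act (w' ++ w1)) (push (act w) u) = push (act w) u.
  rewrite [RHS]ww' push_comp; apply: push_ae_eq.
  by apply: filterS w1P => p /=; rewrite act_cat => ->.
move=> /(push_fixed w2P); rewrite pushE => w1w.
by apply: filterS2 w1P w1w => p /=; rewrite act_cat => ->.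
Qed.

Lemma ue_edge_push (f h : F -> F) u :
  sval u [set p | edge (f p) (h p)] -> edge (push f u : ue F) (push h u : ue F).
Proof.
move=> fh X; rewrite !pushE => hX.
by apply: filterS2 fh hX => p fhp hp; exists (h p).
Qed.

(** If every [k] failed, each would have an [X k] in [v] such that [u] omits the set of [p] with an
    edge to [g k p] in [X k]; the finite intersection of the [X k] then contradicts the edge. *)
Lemma ue_edge_act u v : edge (u : ue F) (v : ue F) ->
  exists k, v = push (g k) u /\ sval u [set p | edge p (g k p)].
Proof.
move=> uv; apply: contrapT => /forallNP nk.
have /choice[X XP] : forall k, exists X,
    sval v X /\ ~ sval u [set p | edge p (g k p) /\ X (g k p)].
  move=> k; have [vk|/nesym/uf_neqP[X vX ukX]] := pselect (v = push (g k) u).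
    exists setT; split=> [|uk]; first exact: filterT.
    by apply: (nk k); split=> //; apply: filterS uk => p [].
  exists X; split=> // uk; apply: ukX; apply: filterS uk => p [] //.
have vX : sval v [set s | forall k, X k s].
  by apply: filter_forall => k; have [] := XP k.
have [|k uk] := @uf_exists _ K (fun k => [set p | edge p (g k p) /\ X k (g k p)]) u.
  apply: filterS (uv _ vX) => p [s [ps Xs]].
  have [k ks] : exists k, g k p = s by apply/gP; apply: Or32.
  by exists k; rewrite /= ks.
by have [_ []] := XP k.
Qed.

Lemma push_act_edge w w' u :
  edge (push (act w) u : ue F) (push (act w') u : ue F) <->
  sval u [set p | edge (act w p) (act w' p)].
Proof.
split=> [/ue_edge_act[k []]|]; last exact: ue_edge_push.
rewrite push_comp => /(push_act_eq w' (k :: w)) w'k; rewrite pushE => kE.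
by apply: filterS2 w'k kE => p /= ->.
Qed.

Definition connected_uf u v := exists w, v = push (act w) u.

Lemma connected_uf_refl u : connected_uf u u.
Proof. by exists [::]; rewrite push_id. Qed.

Lemma connected_uf_sym u v : connected_uf u v -> connected_uf v u.
Proof. by move=> [w ->]; have [w' ww'] := push_act_inverse w u; exists w'. Qed.

Lemma connected_uf_trans u v t :
  connected_uf u v -> connected_uf v t -> connected_uf u t.
Proof. by move=> [w ->] [w' ->]; exists (w' ++ w); rewrite push_act_cat. Qed.

(** * Embedding the ultrafilter extension into the ultrapower *)

Section Embedding.
Variables (I : Type) (D : Uf I) (coord : Uf F -> I -> F).
Hypothesis coordP : forall u, push (coord u) D = u.
Local Notation "*F" := (ultrapower F (sval D)).
Local Notation cl := (@upclass F I D).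

Definition up_act w (f : I -> F) : *F := cl (act w \o f).

Lemma up_act_eq w w' f :
  up_act w f = up_act w' f <-> sval (push f D) [set p | act w p = act w' p].
Proof. exact: upclass_eq. Qed.

Lemma up_act_edge w w' f :
  edge (up_act w f) (up_act w' f) <->
  sval (push f D) [set p | edge (act w p) (act w' p)].
Proof. exact: upclass_edge. Qed.

(** The letter leading to the neighbour varies with the index; [K] being finite, one letter serves
    on a set of [D]. *)
Lemma up_act_neighbor w f (y : *F) :
  edge (up_act w f) y \/ edge y (up_act w f) -> exists w', y = up_act w' f.
Proof.
have [h ->] := upclass_surj y => fh.
have : sval D [set i | exists k, g k (act w (f i)) = h i].
  case: fh => /upclass_edge; apply: filterS => i /= fh; apply/gP.
    exact: Or32.
  exact: Or33.
move=> /uf_exists[k kP]; exists (k :: w); apply/esym/upclass_eq.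
by apply: filterS kP.
Qed.

Lemma up_act_inverse w f h : up_act w f = cl h ->
  exists w', cl f = up_act w' h.
Proof.
move=> /upclass_eq fh; have [w' w'P] := act_inverse w (push f D).
exists w'; apply/upclass_eq; move: w'P; rewrite pushE => w'P.
by apply: filterS2 fh w'P => i /= <-.
Qed.

(** The swap pairs [up_act w f] with [up_act w h]; the hypotheses on words make this a partial
    isomorphism, and [up_act_neighbor] closes both orbits under neighbours. *)
Lemma up_act_swap (f h : I -> F) :
  (forall w w', sval (push f D) [set p | act w p = act w' p] <->
                sval (push h D) [set p | act w p = act w' p]) ->
  (forall w w', sval (push f D) [set p | edge (act w p) (act w' p)] <->
                sval (push h D) [set p | edge (act w p) (act w' p)]) ->
  (forall w w', up_act w f <> up_act w' h) ->
  exists s : *F -> *F,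
    [/\ involutive_automorphism s, s (cl f) = cl h &
        forall x, (forall w, x <> up_act w f) -> (forall w, x <> up_act w h) ->
          s x = x].
Proof.
move=> eqfh edgefh disj.
pose P x y := exists w, x = up_act w f /\ y = up_act w h.
have [||||||s [sA sP sN]] := @swap_automorphism *F P.
- move=> _ _ _ [w [-> ->]] [w' [/up_act_eq ww' ->]].
  exact/up_act_eq/eqfh.
- move=> _ _ _ [w [-> ->]] [w' [-> /up_act_eq ww']].
  exact/up_act_eq/eqfh.
- move=> _ _ _ [w [_ ->]] [w' [wh _]].
  by case: (disj w' w).
- by move=> _ _ y [w [-> _]] /up_act_neighbor[w' ->]; exists (up_act w' h), w'.
- by move=> _ _ y [w [_ ->]] /up_act_neighbor[w' ->]; exists (up_act w' f), w'.
- move=> _ _ _ _ [w [-> ->]] [w' [-> ->]].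
  by rewrite !up_act_edge edgefh.
exists s; split=> // [|x nf nh]; first by apply: sP; exists [::].
by apply: sN => y [w []]; [move/nf|move=> _ /nh].
Qed.

(* Each connected component of the ultrafilter extension is copied along a
   single chosen representative [c v], so that [e] is coherent on components. *)
Lemma ue_section : exists e : ue F -> *F,
  [/\ forall v w f, e v = cl f -> e (push (act w) v) = up_act w f,
      forall v f, e v = cl f -> push f D = v &
      forall u v : ue F, edge u v -> edge (e u) (e v)].
Proof.
have [c [cR cE]] :=
  class_representative connected_uf_refl connected_uf_sym connected_uf_trans.
have /choice[r rP] := cR.
(* [r v] is a word leading from [c v] to [v]. *)
pose e (v : ue F) : *F := up_act (r v) (coord (c v)).
exists e; split=> [v w f /upclass_eq vf|v f /upclass_eq vf|u v uv].
- have cv : c (push (act w) v) = c v by apply/esym/cE; exists w.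
  apply: (@etrans _ _ (up_act (w ++ r v) (coord (c v)))); last first.
    apply/upclass_eq; apply: filterS vf => i /=.
    by rewrite act_cat => ->.
  (* Both words lead from [c v] to the same ultrafilter, so they agree almost everywhere. *)
  rewrite /e cv; apply/up_act_eq; rewrite coordP; apply/push_act_eq.
  by rewrite push_act_cat -rP -{1}cv -rP.
- by rewrite -(push_ae_eq vf) -push_comp coordP -rP.
- have cuv : c u = c v.
    by apply: cE; have [k [-> _]] := ue_edge_act uv; exists [:: k].
  rewrite /e cuv; apply/up_act_edge; rewrite coordP; apply/push_act_edge.
  by rewrite -rP -{1}cuv -rP.
Qed.

Lemma ue_section_elementary (e : ue F -> *F) :
  (forall v w f, e v = cl f -> e (push (act w) v) = up_act w f) ->
  (forall v f, e v = cl f -> push f D = v) ->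
  (forall u v : ue F, edge u v -> edge (e u) (e v)) ->
  elementary_embedding (@pi_ue F) /\ elementary_embedding e.
Proof.
move=> e_act e_st e_edge.
(* Only one point of the ultrapower lies over a principal ultrafilter, since a function inducing it
   equals [x] on a set of [D]. *)
have e_pi (f : I -> F) (x : F) : push f D = pi_ue x -> e (pi_ue x) = cl f.
  have [h eh] := upclass_surj (e (pi_ue x)).
  rewrite eh => fx; have hx := e_st _ _ eh.
  have Dx k : push k D = pi_ue x -> sval D [set i | k i = x].
    by move=> kx; rewrite -(pushE k D [set x]) kx; exact/principal_filterP.
  apply/upclass_eq; apply: filterS2 (Dx _ hx) (Dx _ fx) => i /= -> ->//.
suff eE : elementary_embedding e.
  split=> // n p v; rewrite (eE _ p (@pi_ue F \o v)) (diagonal_elementary D p v).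
  suff -> : e \o (@pi_ue F \o v) = (fun x => cl (fun=> x)) \o v by [].
  apply/funext => j /=; apply: e_pi; apply/esym/uf_eq => A /principal_filterP Ax.
  by rewrite pushE; apply: filterS filterT.
apply: Tarski_Vaught_automorphism => [u v uv|u v|n a b].
- have [f uf] := upclass_surj (e u).
  by rewrite -(e_st _ _ uf); apply: e_st; rewrite -uv.
- split=> [/e_edge//|].
  have [f uf] := upclass_surj (e u); have [h vh] := upclass_surj (e v).
  rewrite uf vh => /upclass_edge fh.
  rewrite -(e_st _ _ uf) -(e_st _ _ vh) => X; rewrite !pushE => hX.
  by apply: filterS2 fh hX => i fhi hi; exists (h i).
have [[b' bb']|nb] := pselect (exists b', b = e b').
  by exists id; split=> //; exists b'.
have [f bf] := upclass_surj b; rewrite {}bf in nb *.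
have np x : push f D <> principal x.
  by move=> /e_pi fx; apply: nb; exists (pi_ue x).
pose S (j : bool * seq K * seq K) : set F := let: (b, w, w') := j in
  if b then [set p | act w p = act w' p] else [set p | edge (act w p) (act w' p)].
(* The ultrafilters to avoid are those connected to a parameter, indexed by a parameter and a
   word. *)
have [v [vS vz]] := countable_type_realized_off S
  (fun j : 'I_n * seq K => push (act j.2) (a j.1)) np.
have [h vh] := upclass_surj (e v); have hv := e_st _ _ vh.
(* The image of [e] is closed under words and words are invertible, so the orbit of a point outside
   stays outside. *)
have orbit_f w u : e u <> up_act w f.
  have [k uk] := upclass_surj (e u); rewrite uk => /esym/up_act_inverse[w' w'P].
  by apply: nb; exists (push (act w') u); rewrite w'P (e_act _ _ _ uk).
have [|||s [sA sf sN]] := @up_act_swap f h.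
- by move=> w w'; rewrite hv; exact: (vS (true, w, w')).
- by move=> w w'; rewrite hv; exact: (vS (false, w, w')).
- by move=> w w'; rewrite -(e_act _ _ _ vh) => /esym/orbit_f.
exists s; split=> //; last by exists v; rewrite sf.
apply/funext => j /=; apply: sN => w; first exact: orbit_f.
(* A parameter in the orbit of [h] would be connected to [v], against the choice of [v]. *)
rewrite -(e_act _ _ _ vh) => aj.
have ajv : a j = push (act w) v.
  have [k ak] := upclass_surj (e (a j)).
  by rewrite -(e_st _ _ ak); apply: e_st; rewrite -aj.
have [w' vw'] : connected_uf (a j) v by apply: connected_uf_sym; exists w.
exact: vz (j, w') vw'.
Qed.

End Embedding.
End NeighborFunctions.

Theorem theorem4p7 (F : digraph) (hF : bounded F) :
  exists (I : Type) (D : set_system I),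
    [/\ UltraFilter D,
        elementary_embedding (@pi_ue F) &
        exists e : ue F -> ultrapower F D, elementary_embedding e].
Proof.
have [K [g gP]] := bounded_neighbor_functions hF.
have [D coordP] := coordinates_realize_all F.
have [e [e_act e_st e_edge]] := ue_section gP coordP.
have [piE eE] := ue_section_elementary gP e_act e_st e_edge.
by exists (Uf F -> F), (sval D); split; [exact: uf_ultra| |exists e].
Qed.
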